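(* Let $G$ be a finite group such that the difference subgroup graph $D(G)$ has at least one edge and the independence number of $D(G)$ is at most $13$. Then either $G$ is a $p$-group (for some prime $p$) or $G$ is not nilpotent.
   Context: For a finite group $G$, the difference subgroup graph $D(G)$ is the undirected graph whose vertices are the non-trivial proper subgroups of $G$, with two distinct vertices $H$ and $K$ adjacent if and only if $\langle H,K\rangle = G$ and $HK\neq G$, where $HK=\{hk : h\in H,\ k\in K\}$. The independence number $\alpha(D(G))$ is the size of a largest set of pairwise non-adjacent vertices of $D(G)$. *)

(* Defs.v *)
From mathcomp Require Import all_boot all_fingroup all_solvable.

Set Implicit Arguments.
Unset Strict Implicit.
Unset Printing Implicit Defensive.

Local Open Scope group_scope.

Section Graph.

Variables (T : finType) (V : {set T}) (e : rel T).

Definition independent (S : {set T}) : bool :=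
  (S \subset V) && [forall x in S, forall y in S, (x != y) ==> ~~ e x y].

Definition independence_number : nat :=
  \max_(S : {set T} | independent S) #|S|.

Definition has_edge : Prop :=
  exists x y : T, [/\ x \in V, y \in V & e x y].

End Graph.

Section DifferenceSubgroupGraph.

Variables (gT : finGroupType) (G : {group gT}).

Definition diff_vertices : {set {group gT}} :=
  [set H : {group gT} | (H :!=: 1) && (H \proper G)].

(* [H * K] is the product set, [H <*> K] the subgroup generated by [H] and
   [K]; the relation is meant to be used on [diff_vertices]. *)
Definition diff_adj : rel {group gT} :=
  fun H K => [&& H != K, H <*> K == G :> {set gT} & H * K != G :> {set gT}].

End DifferenceSubgroupGraph.

(* Main.v *)
(** A subgroup with a neighbour in [D(G)] is not normal.  If [G] is nilpotent,
    some Sylow subgroup [P] of [G] therefore contains a non-normal subgroup [H],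
    and a maximal subgroup [M] of [P] above [H] is not cyclic, as otherwise [H]
    would be characteristic in the normal subgroup [M].  A non-cyclic group has
    three maximal subgroups; let [M1], [M2], [M3] be maximal in [M], and [M],
    [N1], [N2] maximal in [P].  If [G = P \x Q] with [Q] non-trivial, then the
    subgroups [X] and [X * Q], for [X] among [M1], [M2], [M3], [M], [N1], [N2],
    together with [P] and [Q], are [14] vertices, each of them normal in [G] or
    contained in [M * Q]: no two are adjacent. *)

Require Import Defs.
From mathcomp Require Import all_boot all_fingroup all_solvable.

Set Implicit Arguments.
Unset Strict Implicit.
Unset Printing Implicit Defensive.

Local Open Scope group_scope.

Section MaximalSubgroups.

Variable gT : finGroupType.
Implicit Types G H K M : {group gT}.

(** If an element of [H] outside [K] and an element of [K] outside [H] are at hand, their product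
    lies in neither subgroup. *)
Lemma exists_notin_proper2 G H K :
  H \proper G -> K \proper G -> exists2 x, x \in G & x \notin H :|: K.
Proof.
move=> /properP[sHG [x Gx H'x]] /properP[sKG [y Gy K'y]].
have [Kx|K'x] := boolP (x \in K); last by exists x; rewrite // inE negb_or H'x.
have [Hy|H'y] := boolP (y \in H); last by exists y; rewrite // inE negb_or H'y.
by exists (x * y); rewrite ?groupM // inE groupMr // groupMl // negb_or H'x.
Qed.

Lemma noncyclic_maximal_mem G x :
  ~~ cyclic G -> x \in G -> exists2 M : {group gT}, maximal M G & x \in M.
Proof.
move=> ncG Gx; have sxG : <[x]>%G \subset G by rewrite cycle_subG.
have [eqG|[M maxM sxM]] := maximal_exists sxG.
  by case/negP: ncG; rewrite -eqG cycle_cyclic.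
by exists M; rewrite // -cycle_subG.
Qed.

(** A group is not the union of two proper subgroups: take [N1] through an element outside [M], then
    [N2] through an element outside both [M] and [N1]. *)
Lemma noncyclic_two_maximal G M :
    ~~ cyclic G -> maximal M G ->
  exists N1 N2 : {group gT},
    [/\ maximal N1 G, maximal N2 G & uniq [:: M; N1; N2]].
Proof.
move=> ncG maxM; have prM := maxgroupp maxM.
have [x Gx] := exists_notin_proper2 prM prM; rewrite inE orbb => M'x.
have [N1 max1 N1x] := noncyclic_maximal_mem ncG Gx.
have [y Gy] := exists_notin_proper2 prM (maxgroupp max1).
rewrite inE negb_or => /andP[M'y N1'y].
have [N2 max2 N2y] := noncyclic_maximal_mem ncG Gy.
exists N1, N2; split=> //=; rewrite !inE negb_or andbT -andbA; apply/and3P.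
split.
- by apply: contraNneq M'x => ->.
- by apply: contraNneq M'y => ->.
- by apply: contraNneq N1'y => ->.
Qed.

(** A trivial [M] would lie in every subgroup, so by maximality it would equal a maximal subgroup
    chosen through an element outside [M]. *)
Lemma noncyclic_maximal_neq1 G M : ~~ cyclic G -> maximal M G -> M :!=: 1.
Proof.
move=> ncG maxM; have prM := maxgroupp maxM.
have [x Gx] := exists_notin_proper2 prM prM.
rewrite inE orbb => M'x; have [N maxN Nx] := noncyclic_maximal_mem ncG Gx.
have [_ maxM'] := maxgroupP maxM; apply: contraNneq M'x => M1.
by rewrite -(maxM' N) ?M1 ?sub1G // (maxgroupp maxN).
Qed.

(** Since [H] is generated by its Sylow subgroups, [G] fails to normalise one of them, which is a
    [p]-core of [H] by nilpotency. *)
Lemma nilpotent_nonnormal_pcore G H :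
    nilpotent G -> H \subset G -> ~~ (H <| G) ->
  exists2 p, prime p & ~~ ('O_p(H) <| 'O_p(G)).
Proof.
move=> nilG sHG nnHG; have nilH := nilpotentS sHG nilG.
have: ~~ [forall (S : {group gT} | Sylow H S), G \subset 'N(S)].
  apply: contra nnHG => /forall_inP nS; rewrite /normal sHG -(Sylow_gen H).
  by apply: norms_gen; apply: norms_bigcup; apply/bigcapsP.
case/forall_inPn => S /SylowP[p p_pr sylS].
rewrite (nilpotent_Hall_pcore nilH sylS) => nnS; exists p => //.
(* The [p']-core of [G] centralises its [p]-core, so only the [p]-core of [G] can fail to normalise
   a subgroup of it. *)
apply: contra nnS => /andP[sOO nOO].
have [_ defG cOO _] := dprodP (nilpotent_pcoreC p nilG).
rewrite -{1}defG mul_subG // (subset_trans cOO) //.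
by rewrite (subset_trans (centS sOO)) ?cent_sub.
Qed.

End MaximalSubgroups.

Section IndependentSet.

Variables (gT : finGroupType) (G : {group gT}).
Implicit Types H K L M P Q : {group gT}.

(** When one factor is normal, the product set is already the generated subgroup, which contradicts
    the last two clauses of adjacency. *)
Lemma diff_adj_normal H K : H <| G \/ K <| G ->
  H \subset G -> K \subset G -> ~~ diff_adj G H K.
Proof.
move=> nHK sHG sKG; apply/and3P => -[_ /eqP defG /eqP[]].
case: nHK => /andP[_ nG]; rewrite -defG.
  by rewrite norm_joinEr // (subset_trans sKG).
by rewrite norm_joinEl // (subset_trans sHG).
Qed.

Lemma diff_adj_proper H K L :
  L \proper G -> H \subset L -> K \subset L -> ~~ diff_adj G H K.
Proof.
move=> prL sHL sKL; apply/and3P => -[_ /eqP defG _].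
by have := proper_subn prL; rewrite -defG join_subG sHL sKL.
Qed.

Lemma dprod_independence_number (p : nat) P Q H :
    p.-group P -> Q :!=: 1 -> P \x Q = G -> H \subset P -> ~~ (H <| P) ->
  14 <= independence_number (diff_vertices G) (diff_adj G).
Proof.
move=> pP ntQ /dprodP[_ defG cPQ tiPQ] sHP nnHP.
have neHP : H :!=: P by apply: contraNneq nnHP => ->.
have [/eqP|[M maxM sHM]] := maximal_exists sHP; first by rewrite (negPf neHP).
have nsMP := p_maximal_normal pP maxM; have sMP := normal_sub nsMP.
have ncM : ~~ cyclic M.
  apply: contra nnHP => cycM; apply: char_normal_trans nsMP.
  by rewrite sub_cyclic_char.
have ncP : ~~ cyclic P by apply: contra ncM; apply: cyclicS.
have [N1 [N2 [maxN1 maxN2 uN]]] := noncyclic_two_maximal ncP maxM.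
(* The identity serves only to produce some maximal subgroup of [M]. *)
have [M1 maxM1 _] := noncyclic_maximal_mem ncM (group1 M).
have [M2 [M3 [maxM2 maxM3 uM]]] := noncyclic_two_maximal ncM maxM1.
pose s := [:: M1; M2; M3; M; N1; N2].
have sM (X : {group gT}) :
  X \in [:: M1; M2; M3] -> [/\ X :!=: 1, X \proper M & X \proper P].
  move=> sX; have maxX : maximal X M by move: sX; rewrite !inE => /or3P[]/eqP->.
  have prX := maxgroupp maxX; split=> //; last exact: proper_sub_trans sMP.
  exact: noncyclic_maximal_neq1 maxX.
have sN (X : {group gT}) : X \in [:: M; N1; N2] -> maximal X P.
  by rewrite !inE => /or3P[]/eqP->.
have s_cat : s = [:: M1; M2; M3] ++ [:: M; N1; N2] by [].
have s_nt_pr (X : {group gT}) : X \in s -> X :!=: 1 /\ X \proper P.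
  rewrite s_cat mem_cat => /orP[/sM[]|/sN maxX] //.
  by split; [exact: noncyclic_maximal_neq1 maxX | exact: maxgroupp maxX].
have s_sub_normal (X : {group gT}) : X \in s -> X \subset M \/ X <| P.
  rewrite s_cat mem_cat => /orP[/sM[_ /proper_sub]|/sN maxX]; first by left.
  by right; exact: p_maximal_normal pP maxX.
have us : uniq s.
  (* A subgroup in both halves would be maximal in [P] and yet properly contained in [M], itself
     proper in [P]. *)
  rewrite s_cat cat_uniq uM uN andbT andTb; apply/hasPn => X /sN maxX.
  apply/negP => /sM[_ prXM _]; have [_ maxX'] := maxgroupP maxX.
  have := proper_neq prXM.
  by rewrite -(maxX' M) ?eqxx ?(maxgroupp maxM) ?proper_sub.
have [sPG sQG] : P \subset G /\ Q \subset G.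
  by rewrite -defG mulG_subl mulG_subr.
have normal_G (X : {group gT}) : X <| P -> X <| G.
  case/andP=> sXP nXP; rewrite /normal (subset_trans sXP) // -defG mul_subG //.
  by rewrite (subset_trans cPQ) // (subset_trans (centS sXP)) // cent_sub.
have nsQG : Q <| G.
  by rewrite /normal sQG -defG mul_subG ?normG // cents_norm // centsC.
(* By the modular law, intersecting with [P] undoes joining with [Q]; hence the joins stay distinct,
   and proper for proper [X]. *)
have joinQI (X : {group gT}) : X \subset P -> (X <*> Q) :&: P = X.
  move=> sXP; rewrite cent_joinEr ?(subset_trans cPQ) ?centS //.
  by rewrite -group_modl // [Q :&: P]setIC tiPQ mulg1.
(* Seven vertices come from [A], seven more from joining [Q] to the members of [B]; the trivial
   group in [B] accounts for [Q] itself. *)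
pose A := P :: s; pose B := 1%G :: s.
have Bpr (X : {group gT}) : X \in B -> X \proper P.
  rewrite inE => /predU1P[->|/s_nt_pr[]//]; rewrite proper1G.
  by apply: contraNneq ncP => ->; exact: cyclic1.
have uA : uniq A.
  by rewrite cons_uniq us andbT; apply/negP => /s_nt_pr[_]; rewrite properxx.
have uB : uniq B.
  by rewrite cons_uniq us andbT; apply/negP => /s_nt_pr[]; rewrite eqxx.
pose S := A ++ [seq (X <*> Q)%G | X : {group gT} <- B].
have uS : uniq S.
  rewrite cat_uniq uA map_inj_in_uniq ?uB ?andbT => [|X Y
    /Bpr prX /Bpr prY eqXY].
    (* Members of [A] lie in [P], whereas a join contains [Q]; a coincidence would put [Q] inside
       [P :&: Q], which is trivial. *)
    apply/hasPn => _ /mapP[X _ ->]; apply/negP => A_XQ.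
    have sXQP : X <*> Q \subset P.
      move: A_XQ; rewrite inE => /predU1P[eqXQP|/s_nt_pr[_ /proper_sub]//].
      by move: (subxx P); rewrite -{1}eqXQP.
    case/eqP: ntQ; apply/trivgP; rewrite -tiPQ subsetI subxx andbT.
    exact: subset_trans (joing_subr _ _) sXQP.
  have /= eqXQ := congr1 (@gval gT) eqXY; apply: val_inj => /=.
  by rewrite -(joinQI X) ?proper_sub // eqXQ joinQI ?proper_sub.
have prPG : P \proper G.
  rewrite properE sPG; apply: contra ntQ => sGP.
  by apply/eqP/trivgP; rewrite -tiPQ subsetI subxx (subset_trans sQG).
have pr_joinQ (X : {group gT}) : X \proper P -> X <*> Q \proper G.
  move=> prX; have sXP := proper_sub prX; rewrite properE join_subG sQG.
  rewrite (subset_trans sXP) //=; apply: contra (proper_subn prX) => sGXQ.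
  by rewrite -(joinQI X) // subsetI subxx (subset_trans sPG).
have SV (X : {group gT}) : X \in S -> X \in diff_vertices G.
  rewrite [X \in diff_vertices G]inE mem_cat => /orP[AX | /mapP[Y /Bpr prY ->]].
    move: AX; rewrite inE => /predU1P[->|/s_nt_pr[-> prX]]; last first.
      exact: proper_trans prX prPG.
    by rewrite prPG andbT; apply: contraNneq ncP => ->; exact: cyclic1.
  rewrite /= pr_joinQ // andbT; apply: contraNneq ntQ => XQ1.
  by apply/eqP/trivgP; rewrite -XQ1 joing_subr.
have S_cases (X : {group gT}) : X \in S -> X \subset M <*> Q \/ X <| G.
  rewrite mem_cat => /orP[|/mapP[Y BY ->]].
    rewrite inE => /predU1P[->|/s_sub_normal[sXM|]];
      try by right; apply: normal_G.
    by left; apply: subset_trans sXM (joing_subl _ _).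
  move: BY; rewrite inE => /predU1P[->|/s_sub_normal[sYM|/normal_G nsYG]].
  - by left; rewrite join_subG sub1G joing_subr.
  - by left; rewrite join_subG joing_subr (subset_trans sYM) ?joing_subl.
  - by right; exact: normalY.
have prMQ : M <*> Q \proper G by apply: pr_joinQ; exact: maxgroupp maxM.
have <- : #|[set:: S]| = 14 by rewrite cardsE (card_uniqP uS).
apply: leq_bigmax_cond; rewrite /independent; apply/andP; split.
  by apply/subsetP => X; rewrite inE; exact: SV.
apply/forall_inP => X; rewrite inE => SX.
apply/forall_inP => Y; rewrite inE => SY.
apply/implyP => _.
have sSG (Z : {group gT}) : Z \in S -> Z \subset G.
  by move/SV; rewrite inE => /andP[_ /proper_sub].
have [sX|nX] := S_cases X SX; last by apply: diff_adj_normal; auto.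
have [sY|nY] := S_cases Y SY; last by apply: diff_adj_normal; auto.
exact: diff_adj_proper prMQ sX sY.
Qed.

End IndependentSet.

Theorem theorem5p2 (gT : finGroupType) (G : {group gT})
  (hedge : has_edge (diff_vertices G) (diff_adj G))
  (halpha : independence_number (diff_vertices G) (diff_adj G) <= 13) :
  (exists p : nat, prime p /\ p.-group G)%g \/ ~~ nilpotent G.
Proof.
have [nilG|nnilG] := boolP (nilpotent G); [left | by right].
have [H [K [VH VK adjHK]]] := hedge.
move: VH VK; rewrite !inE => /andP[_ /proper_sub sHG] /andP[_ /proper_sub sKG].
have nnHG : ~~ (H <| G).
  apply: contraL adjHK => nsHG.
  by apply: diff_adj_normal; auto.
have [p p_pr nnOp] := nilpotent_nonnormal_pcore nilG sHG nnHG.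
(* If [G] is not a [p]-group, its [p']-core is non-trivial and can play the part of [Q], with the
   [p]-core as [P]. *)
exists p; split=> //; apply: contraLR halpha => pG'; rewrite -ltnNge.
have defG := nilpotent_pcoreC p nilG.
apply: (dprod_independence_number _ _ defG _ nnOp); first exact: pcore_pgroup.
  apply: contra pG' => /eqP O1; rewrite -defG O1 dprodg1; exact: pcore_pgroup.
(* The [p]-core of a nilpotent group is a normal Hall subgroup, so it contains every [p]-subgroup,
   in particular the [p]-core of [H]. *)
rewrite (sub_normal_Hall (nilpotent_pcore_Hall p nilG)) ?pcore_normal //.
  exact: pcore_pgroup.
exact: subset_trans (pcore_sub _ _) sHG.
Qed.
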